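(* Let $n\ge1$. The class of $(\langle\ \rangle;,\mathsf A_1,\dots,\mathsf A_n,\sqcup)$-algebras that are representable by $n$-ary partial functions is a variety, finitely axiomatised by the following equations (each universally quantified over all element variables occurring in it): (1) $\langle \boldsymbol a; b_1,\dots,\boldsymbol a; b_n\rangle ; c = \boldsymbol a;(\boldsymbol b; c)$; (2) $\boldsymbol\pi; a = a$; (3) $\langle \mathsf A_1^n a\rangle; a = 0$ (i.e. $\langle \mathsf A_1^n a\rangle; a=\langle \mathsf A_1^n b\rangle; b$ for all $a,b$, so that $0$ is a well-defined constant); (4) $\langle a_1,\dots,a_{i-1},0,a_{i+1},\dots,a_n\rangle; b = 0$ for every $i$; (5) $\boldsymbol a; 0 = 0$; (6) $\boldsymbol a;\mathsf A_i b = \langle \mathsf A_1^n(\boldsymbol a; b)\rangle;\langle \mathsf D_1^n a_1\rangle;\cdots;\langle \mathsf D_1^n a_n\rangle; a_i$ for every $i$; (7) $\langle \mathsf D_1^n a\rangle; a = a$; (8) $\mathsf A_i\mathsf A_j a=\mathsf A_i\mathsf A_k a$ for every $i,j,k$; (9) $\langle \mathsf D_1^n a\rangle;(a\sqcup b)=a$; (10) $\langle \mathsf A_1^n a\rangle;(a\sqcup b)=\langle \mathsf A_1^n a\rangle; b$; (11) $(\langle \mathsf D_1^n a\rangle; b)\sqcup(\langle \mathsf A_1^n a\rangle; b)=b$.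
   Context: Fix $n\ge 1$; indices $i,j,k$ range over $\{1,\dots,n\}$. The signature has an $(n+1)$-ary operation (composition), written $\langle a_1,\dots,a_n\rangle ; b$, unary operations $\mathsf A_1,\dots,\mathsf A_n$, and a binary operation $\sqcup$. Algebras are nonempty. An $n$-ary partial function on a set $X$ is a set $f\subseteq X^{n+1}$ such that $(\boldsymbol x,y),(\boldsymbol x,z)\in f$ implies $y=z$ (where $\boldsymbol x\in X^n$). An algebra of $n$-ary partial functions of this signature is an algebra whose elements are $n$-ary partial functions, for which there are a set $X$ (the base) and an equivalence relation $E$ on $X$ such that every tuple $(x_1,\dots,x_{n+1})$ in every element lies in $X^{n+1}$ and has pairwise $E$-equivalent entries, and whose operations are $\boldsymbol f; g=\{(\boldsymbol x,z)\in X^{n+1} : \exists \boldsymbol y\in X^n,\ (\boldsymbol x,y_i)\in f_i \text{ for each } i \text{ and } (\boldsymbol y,z)\in g\}$, $\mathsf A_i(f)=\{(\boldsymbol x,x_i)\in X^{n+1} : x_1,\dots,x_n \text{ all } E\text{-equivalent and there is no } y\in X \text{ with } (\boldsymbol x,y)\in f\}$, and preferential union: $(f\sqcup g)(\boldsymbol x)$ is $f(\boldsymbol x)$ if $f(\boldsymbol x)$ is defined, $g(\boldsymbol x)$ if $f(\boldsymbol x)$ is undefined but $g(\boldsymbol x)$ is defined, and undefined otherwise. An algebra is representable by $n$-ary partial functions if it is isomorphic to an algebra of $n$-ary partial functions of the same signature. Notation: a bold symbol $\boldsymbol a$ in a term $\boldsymbol a; b$ stands for $\langle a_1,\dots,a_n\rangle$;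 unbracketed compositions associate to the right ($\boldsymbol a;\boldsymbol b; c=\boldsymbol a;(\boldsymbol b; c)$); for unary operations $\mathsf B_1,\dots,\mathsf B_n$, $\langle \mathsf B_1^n a\rangle$ means $\langle \mathsf B_1 a,\dots,\mathsf B_n a\rangle$. Abbreviations: $0:=\langle \mathsf A_1^n b\rangle; b$ for any $b$; $\pi_i:=\mathsf A_i 0$; $\boldsymbol\pi:=\langle\pi_1,\dots,\pi_n\rangle$; $\mathsf D_i a:=\mathsf A_i\mathsf A_i a$. *)

(* Defs.v *)
From Stdlib Require List.
From mathcomp Require Import all_boot.
From mathcomp Require Import boolp classical_sets.

Set Implicit Arguments.
Unset Strict Implicit.
Unset Printing Implicit Defensive.

Local Open Scope classical_set_scope.

Record algebra (n : nat) : Type := Algebra {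
  carrier :> Type;
  carrier_nonempty : inhabited carrier;
  comp : ('I_n -> carrier) -> carrier -> carrier;
  anti : 'I_n -> carrier -> carrier;
  pref : carrier -> carrier -> carrier }.

Arguments comp {n} _ _ _.
Arguments anti {n} _ _ _.
Arguments pref {n} _ _ _.

Record homomorphism (n : nat) (A B : algebra n) (h : A -> B) : Prop := Homomorphism {
  hom_comp : forall (f : 'I_n -> A) (g : A),
    h (comp A f g) = comp B (fun i => h (f i)) (h g);
  hom_anti : forall (i : 'I_n) (f : A), h (anti A i f) = anti B i (h f);
  hom_pref : forall f g : A, h (pref A f g) = pref B (h f) (h g) }.

Definition isomorphic (n : nat) (A B : algebra n) : Prop :=
  exists2 h : A -> B, homomorphism h & bijective h.

Lemma prod_nonempty (n : nat) (I : Type) (A : I -> algebra n) :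
  inhabited (forall i, A i).
Proof.
have P (i : I) : exists x : A i, True.
  by case: (carrier_nonempty (A i)) => x; exists x.
exact: (inhabits (fun i => projT1 (cid (P i)))).
Qed.

Definition prod_algebra (n : nat) (I : Type) (A : I -> algebra n) : algebra n :=
  @Algebra n (forall i, A i) (prod_nonempty A)
    (fun f g i => comp (A i) (fun j => f j i) (g i))
    (fun j f i => anti (A i) j (f i))
    (fun f g i => pref (A i) (f i) (g i)).

(* Closure under homomorphic images, subalgebras and products; each clause also
   gives closure under isomorphism, and the empty product puts the one-element
   algebra in the class, so that a variety is never empty. *)
Record is_variety (n : nat) (K : algebra n -> Prop) : Prop := IsVariety {
  variety_H : forall (A B : algebra n) (h : A -> B),
    homomorphism h -> (forall y, exists x, h x = y) -> K A -> K B;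
  variety_S : forall (A B : algebra n) (h : B -> A),
    homomorphism h -> injective h -> K A -> K B;
  variety_P : forall (I : Type) (A : I -> algebra n) (B : algebra n),
    isomorphic B (prod_algebra A) -> (forall i, K (A i)) -> K B }.

(* X^(n+1) is taken to be X^n * X, and X^n to be 'I_n -> X. *)
Section PartialFunctions.
Variables (n : nat) (X : Type) (E : X -> X -> Prop).
Implicit Types f g : set (('I_n -> X) * X).

Definition functional f : Prop :=
  forall x y z, f (x, y) -> f (x, z) -> y = z.

Definition all_equivalent (x : 'I_n -> X) : Prop := forall i j, E (x i) (x j).

Definition entries_equivalent f : Prop :=
  forall x y, f (x, y) -> all_equivalent x /\ (forall i, E (x i) y).

Definition pf_comp (fs : 'I_n -> set (('I_n -> X) * X)) g :
    set (('I_n -> X) * X) :=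
  [set p | exists y : 'I_n -> X, (forall i, fs i (p.1, y i)) /\ g (y, p.2)].

Definition pf_anti (i : 'I_n) f : set (('I_n -> X) * X) :=
  [set p | [/\ p.2 = p.1 i, all_equivalent p.1 & ~ exists y, f (p.1, y)]].

Definition pf_pref f g : set (('I_n -> X) * X) :=
  [set p | f p \/ (~ exists y, f (p.1, y)) /\ g p].

End PartialFunctions.

Record pf_algebra (n : nat) : Type := PfAlgebra {
  base : Type;
  base_rel : base -> base -> Prop;
  base_rel_equiv : RelationClasses.Equivalence base_rel;
  elements : set (set (('I_n -> base) * base));
  elements_nonempty : exists f, elements f;
  elements_functional : forall f, elements f -> functional f;
  elements_equivalent : forall f, elements f -> entries_equivalent base_rel f;
  elements_comp : forall fs g,
    (forall i, elements (fs i)) -> elements g -> elements (pf_comp fs g);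
  elements_anti : forall i f, elements f -> elements (pf_anti base_rel i f);
  elements_pref : forall f g,
    elements f -> elements g -> elements (pf_pref f g) }.

Arguments elements {n} _ _.

Lemma elements_inhabited (n : nat) (P : pf_algebra n) :
  inhabited {f | elements P f}.
Proof. by case: (elements_nonempty P) => f Pf; exact: (inhabits (exist _ f Pf)). Qed.

Definition algebra_of_pf (n : nat) (P : pf_algebra n) : algebra n :=
  @Algebra n {f | elements P f} (elements_inhabited P)
    (fun fs g => exist _ _
       (elements_comp (fun i => proj2_sig (fs i)) (proj2_sig g)))
    (fun i f => exist _ _ (elements_anti i (proj2_sig f)))
    (fun f g => exist _ _ (elements_pref (proj2_sig f) (proj2_sig g))).

Definition representable (n : nat) (A : algebra n) : Prop :=
  exists P : pf_algebra n, isomorphic A (algebra_of_pf P).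

(* Countably many element variables, and countably many n-tuples of them. *)
Inductive var (n : nat) : Type :=
  | Elt of nat
  | Coord of nat & 'I_n.

Inductive term (n : nat) : Type :=
  | Var of var n
  | Comp of ('I_n -> term n) & term n
  | Anti of 'I_n & term n
  | Pref of term n & term n.

Fixpoint eval (n : nat) (A : algebra n) (v : var n -> A) (t : term n) : A :=
  match t with
  | Var x => v x
  | Comp f g => comp A (fun i => eval v (f i)) (eval v g)
  | Anti i f => anti A i (eval v f)
  | Pref f g => pref A (eval v f) (eval v g)
  end.

Record equation (n : nat) : Type := Equation { lhs : term n; rhs : term n }.

Definition satisfies (n : nat) (A : algebra n) (e : equation n) : Prop :=
  forall v : var n -> A, eval v (lhs e) = eval v (rhs e).

Definition axiomatised_by (n : nat) (K : algebra n -> Prop)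
    (L : seq (equation n)) : Prop :=
  forall A : algebra n, K A <-> (forall e, List.In e L -> satisfies A e).

Declare Scope pf_term_scope.
Delimit Scope pf_term_scope with pft.
Notation "f ;; g" := (Comp f g)
  (at level 35, right associativity) : pf_term_scope.
Notation "f ⊔ g" := (Pref f g)
  (at level 50, left associativity) : pf_term_scope.
Notation "s ≈ t" := (Equation s t)
  (at level 70, no associativity) : pf_term_scope.

Section Equations.
Variable n : nat.
Local Open Scope pf_term_scope.

Definition antis (t : term n) : 'I_n -> term n := fun i => Anti i t.
Definition doms (t : term n) : 'I_n -> term n := fun i => Anti i (Anti i t).

(* The element variable used in [zero] occurs nowhere else in the axioms, so
   that [ax3] says that the value of [zero] does not depend on it. *)
Definition zero : term n := antis (Var (Elt n 0)) ;; Var (Elt n 0).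
Definition proj : 'I_n -> term n := fun i => Anti i zero.

Let a : term n := Var (Elt n 1).
Let b : term n := Var (Elt n 2).
Let c : term n := Var (Elt n 3).
Let a_ (i : 'I_n) : term n := Var (Coord 0 i).
Let b_ (i : 'I_n) : term n := Var (Coord 1 i).

Definition ax1 := (fun i => a_ ;; b_ i) ;; c ≈ a_ ;; b_ ;; c.
Definition ax2 := proj ;; a ≈ a.
Definition ax3 := antis a ;; a ≈ zero.
Definition ax4 (i : 'I_n) :=
  (fun j => if j == i then zero else a_ j) ;; b ≈ zero.
Definition ax5 := a_ ;; zero ≈ zero.
(* [foldr] over [enum 'I_n] is the composite
   <D a_1>; (<D a_2>; ... (<D a_n>; a_i)). *)
Definition ax6 (i : 'I_n) :=
  a_ ;; Anti i b ≈
  antis (a_ ;; b) ;; foldr (fun j t => doms (a_ j) ;; t) (a_ i) (enum 'I_n).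
Definition ax7 := doms a ;; a ≈ a.
Definition ax8 (i j k : 'I_n) := Anti i (Anti j a) ≈ Anti i (Anti k a).
Definition ax9 := doms a ;; (a ⊔ b) ≈ a.
Definition ax10 := antis a ;; (a ⊔ b) ≈ antis a ;; b.
Definition ax11 := (doms a ;; b) ⊔ (antis a ;; b) ≈ b.

Definition pf_axioms : seq (equation n) :=
  [:: ax1; ax2; ax3] ++
  [seq ax4 i | i <- enum 'I_n] ++
  [:: ax5] ++
  [seq ax6 i | i <- enum 'I_n] ++
  [:: ax7] ++
  flatten [seq flatten [seq [seq ax8 i j k | k <- enum 'I_n]
                       | j <- enum 'I_n] | i <- enum 'I_n] ++
  [:: ax9; ax10; ax11].

End Equations.

(* Main.v *)
From mathcomp Require Import all_boot.
From Stdlib Require List.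
From mathcomp Require Import boolp classical_sets.
Require Import Defs.

Set Implicit Arguments.
Unset Strict Implicit.
Unset Printing Implicit Defensive.

(** Why the theorem is true. A class cut out by equations is closed under
    homomorphic images, subalgebras and products, so everything rests on the
    axiomatisation, and there the work is to represent an algebra [A] satisfying
    the equations.

    For an element [d] the tuple [<D_1 d, ..., D_n d>] acts on [A] by
    composition, as restriction to the domain of [d] ([res d]), and
    [<A_1 d, ..., A_n d>] acts as restriction to its complement ([cores d]).
    The last equation says that an element is recovered from its two
    restrictions, so an identity may be proved separately inside and outside the
    domain of [d] ([split_eq]). Together with the twisted law for
    [<t>; A_i b], this case analysis gives that restrictions commute, are
    idempotent, and that the domains form a Boolean algebra ([coresC],
    [res_anti], [res_of_res]).

    An ultrafilter [U] of domains is recorded as the set of the elements whose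
    domain belongs to it, which are thought of as the elements defined at [U].
    Two elements have the same germ at [U] when they agree after restriction to
    some member of [U]. The points of the base are the germs of elements defined
    at the various ultrafilters, two points being equivalent when they lie over
    the same ultrafilter, and [f] is represented by the partial function
    [([a_1], ..., [a_n]) |-> [<a_1, ..., a_n>; f]], defined when the composite is
    defined at [U]. It respects the operations because composition is compatible
    with germs ([germ_comp]), because at a tuple where [f] is undefined
    [<a>; A_i f] has the germ of [a_i] ([germ_comp_anti]), and because
    [<a>; (f pref g)] has the germ of [<a>; f] or of [<a>; g] according to
    whether [f] is defined there ([germ_comp_pref1], [germ_comp_pref2]).

    The representation is faithful because distinct elements [f] and [g] are
    separated by an ultrafilter ([ultra_separation]): take a maximal set of
    domains no finite intersection of which makes [f] and [g] agree. By case
    analysis again, such a set contains every domain or its complement. *)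

Definition cores (n : nat) (A : algebra n) (a b : A) : A :=
  comp A (fun i => anti A i a) b.

Definition res (n : nat) (A : algebra n) (a b : A) : A :=
  comp A (fun i => anti A i (anti A i a)) b.

(** The equations, stated for the elements of [A] and with [z] for the
    constant zero. *)
Record laws (n : nat) (A : algebra n) (z : A) : Prop := Laws {
  comp_assoc : forall (t s : 'I_n -> A) c,
    comp A (fun i => comp A t (s i)) c = comp A t (comp A s c);
  cores_zero : forall a : A, cores z a = a;
  cores_self : forall a : A, cores a a = z;
  comp_coord_zero : forall (t : 'I_n -> A) i b, t i = z -> comp A t b = z;
  comp_zero : forall t : 'I_n -> A, comp A t z = z;
  comp_anti : forall (t : 'I_n -> A) i b,
    comp A t (anti A i b) =
    cores (comp A t b) (foldr (fun j (u : A) => res (t j) u) (t i) (enum 'I_n));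
  res_self : forall a : A, res a a = a;
  anti_antiC : forall i j k (a : A),
    anti A i (anti A j a) = anti A i (anti A k a);
  res_pref : forall a b : A, res a (pref A a b) = a;
  cores_pref : forall a b : A, cores a (pref A a b) = cores a b;
  pref_split : forall a b : A, pref A (res a b) (cores a b) = b }.

(** * The equations as identities between elements *)

Section Equations.
Variable n : nat.

Lemma In_catP (T : Type) (s1 s2 : seq T) e :
  List.In e (s1 ++ s2) <-> List.In e s1 \/ List.In e s2.
Proof. exact: List.in_app_iff. Qed.

Lemma In_map_enum (T : Type) (F : 'I_n -> T) e :
  List.In e [seq F i | i <- enum 'I_n] <-> exists i, e = F i.
Proof.
rewrite List.in_map_iff; split=> [[i [<- _]]|[i ->]]; first by exists i.
exists i; split=> //.
by have: i \in enum 'I_n by [rewrite mem_enum]; elim: (enum 'I_n) => //= j s IHs;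
  rewrite inE => /orP[/eqP ->|/IHs]; [left|right].
Qed.

Lemma In_flatten_enum (T : Type) (F : 'I_n -> seq T) e :
  List.In e (flatten [seq F i | i <- enum 'I_n]) <->
  exists i, List.In e (F i).
Proof.
have -> : flatten [seq F i | i <- enum 'I_n] =
          List.concat [seq F i | i <- enum 'I_n].
  by elim: (enum 'I_n) => //= i s ->.
rewrite List.in_concat; split=> [[s []]|[i Fi]].
  by move=> /In_map_enum[i ->] ?; exists i.
by exists (F i); split=> //; apply/In_map_enum; exists i.
Qed.

Lemma eval_foldr_doms (A : algebra n) (v : var n -> A) (t : 'I_n -> term n) u
    (s : seq 'I_n) :
  eval v (foldr (fun j u => Comp (doms (t j)) u) u s) =
  foldr (fun j (u : A) => res (eval v (t j)) u) (eval v u) s.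
Proof. by elim: s => //= j s ->. Qed.

Lemma eval_hom (A B : algebra n) (h : A -> B) :
  homomorphism h -> forall (v : var n -> A) (w : var n -> B),
  (forall x, h (v x) = w x) -> forall t, h (eval v t) = eval w t.
Proof.
case=> hC hA hP v w vw; elim=> //= [f IHf g IHg|i f IHf|f IHf g IHg].
- by rewrite hC IHg; congr (comp B _ _); apply/funext => i.
- by rewrite hA IHf.
- by rewrite hP IHf IHg.
Qed.

(** [c] sits at the variable reserved for the zero term, and also serves as
    the third element variable. *)
Definition valuation (A : algebra n) (a b c : A) (t s : 'I_n -> A) (x : var n) :=
  match x with
  | Elt k => nth c [:: c; a; b] k
  | Coord 0 i => t i
  | Coord _ i => s i
  end.

Lemma satisfies_laws (A : algebra n) :
  (forall e, List.In e (pf_axioms n) -> satisfies A e) ->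
  exists z : A, laws z.
Proof.
move=> Aax; case: (carrier_nonempty A) => o.
pose v := @valuation A.
have ax e : List.In e (pf_axioms n) ->
    forall w : var n -> A, eval w (lhs e) = eval w (rhs e).
  exact: Aax.
have A3 (a b : A) : cores a a = cores b b.
  have /ax/(_ (v a a b (fun=> a) (fun=> a))) : List.In (ax3 n) (pf_axioms n).
    by rewrite /pf_axioms; do ?[by left|right].
  exact.
exists (cores o o); split.
- move=> t s c; have /ax/(_ (v c c c t s)) : List.In (ax1 n) (pf_axioms n).
    by rewrite /pf_axioms; do ?[by left|right].
  exact.
- move=> a; have /ax/(_ (v a a o (fun=> a) (fun=> a))) :
      List.In (ax2 n) (pf_axioms n).
    by rewrite /pf_axioms; do ?[by left|right].
  exact.
- by move=> a; exact: A3.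
- move=> t i b ti0; have /ax/(_ (v b b o t t)) : List.In (ax4 i) (pf_axioms n).
    rewrite /pf_axioms; apply/In_catP; right; apply/In_catP; left.
    by apply/In_map_enum; exists i.
  move=> e; rewrite -[RHS]e; congr (comp A _ _); apply/funext => j.
  by case: (eqVneq j i) => [->|].
- move=> t; have /ax/(_ (v o o o t t)) : List.In (ax5 n) (pf_axioms n).
    rewrite /pf_axioms; do 2 (apply/In_catP; right).
    by left.
  exact.
- move=> t i b; have /ax/(_ (v o b o t t)) : List.In (ax6 i) (pf_axioms n).
    rewrite /pf_axioms; do 3 (apply/In_catP; right); apply/In_catP; left.
    by apply/In_map_enum; exists i.
  by rewrite /= eval_foldr_doms.
- move=> a; have /ax/(_ (v a a a (fun=> a) (fun=> a))) :
      List.In (ax7 n) (pf_axioms n).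
    by rewrite /pf_axioms; do 4 (apply/In_catP; right); left.
  exact.
- move=> i j k a; have /ax/(_ (v a a a (fun=> a) (fun=> a))) :
      List.In (ax8 i j k) (pf_axioms n).
    rewrite /pf_axioms; do 5 (apply/In_catP; right); apply/In_catP; left.
    apply/In_flatten_enum; exists i; apply/In_flatten_enum; exists j.
    by apply/In_map_enum; exists k.
  exact.
- move=> a b; have /ax/(_ (v a b a (fun=> a) (fun=> a))) :
      List.In (ax9 n) (pf_axioms n).
    by rewrite /pf_axioms; do 6 (apply/In_catP; right); left.
  exact.
- move=> a b; have /ax/(_ (v a b a (fun=> a) (fun=> a))) :
      List.In (ax10 n) (pf_axioms n).
    by rewrite /pf_axioms; do 6 (apply/In_catP; right); right; left.
  exact.
- move=> a b; have /ax/(_ (v a b a (fun=> a) (fun=> a))) :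
      List.In (ax11 n) (pf_axioms n).
    by rewrite /pf_axioms; do 6 (apply/In_catP; right); right; right; left.
  exact.
Qed.

Lemma laws_satisfies (A : algebra n) (z : A) : laws z ->
  forall e, List.In e (pf_axioms n) -> satisfies A e.
Proof.
move=> L e.
have zE v : eval v (zero n) = z by exact: (cores_self L).
have piE v (a : A) : comp A (fun i => eval v (proj i)) a = a.
  rewrite -[RHS](cores_zero L); congr (comp A _ _); apply/funext => i.
  by rewrite -[in RHS](zE v).
do ![move=> /In_catP[]] => /=.
- case=> [<-|[<-|[<-|//]]] v.
  + exact: (comp_assoc L).
  + exact: piE.
  + exact: etrans (cores_self L _) (esym (zE v)).
- move=> /In_map_enum[i ->] v; apply: etrans (esym (zE v)).
  by apply: (comp_coord_zero L (i := i)); rewrite eqxx; exact: (zE v).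
- case=> [<-|//] v; rewrite [RHS](zE v).
  by rewrite -[RHS](comp_zero L (fun i => v (Coord 0 i))) -[in RHS](zE v).
- move=> /In_map_enum[i ->] v.
  by rewrite /= eval_foldr_doms; exact: (comp_anti L).
- by case=> [<-|//] v; exact: (res_self L).
- move=> /In_flatten_enum[i] /In_flatten_enum[j] /In_map_enum[k ->] v.
  exact: (anti_antiC L).
- case=> [<-|[<-|[<-|//]]] v.
  + exact: (res_pref L).
  + exact: (cores_pref L).
  + exact: (pref_split L).
Qed.

End Equations.

(** * Soundness for partial functions *)

Section Soundness.
Variables (n : nat) (hn : (0 < n)%N) (P : pf_algebra n).
Local Notation B := (algebra_of_pf P).
Local Notation E := (@base_rel n P).
Implicit Types f g : B.

Let i0 : 'I_n := Ordinal hn.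

Let memB f p : Prop := sval f p.

Lemma pf_ext f g : (forall x y, memB f (x, y) <-> memB g (x, y)) -> f = g.
Proof.
move=> fg; have e : sval f = sval g.
  by apply/funext => -[x y]; apply/propext; exact: fg.
case: f g e {fg} => [f Pf] [g Pg] /= e; subst g.
by rewrite (Prop_irrelevance Pf Pg).
Qed.

Lemma all_equivalent_dom f x y : memB f (x, y) -> all_equivalent E x.
Proof. by move=> /(elements_equivalent (proj2_sig f))[]. Qed.

Lemma mem_anti i f x y : memB (anti B i f) (x, y) <->
  [/\ y = x i, all_equivalent E x & ~ exists z, memB f (x, z)].
Proof. by []. Qed.

Lemma mem_comp (t : 'I_n -> B) g x z : memB (comp B t g) (x, z) <->
  exists y, (forall i, memB (t i) (x, y i)) /\ memB g (y, z).
Proof. by []. Qed.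

(** That [D_i f] is defined exactly where [f] is uses the projections
    themselves as the values witnessing definedness of [A_j f]. *)
Lemma mem_anti_anti i j f x y : memB (anti B i (anti B j f)) (x, y) <->
  [/\ y = x i, all_equivalent E x & exists z, memB f (x, z)].
Proof.
rewrite mem_anti; split=> -[-> xE xf]; split=> //.
  by apply: contrapT => xnf; apply: xf; exists (x j).
by case=> w /mem_anti[].
Qed.

(** The tuple of the [A_i f] is the identity on the tuples where [f] is
    undefined. For the converse inclusion the entries of a tuple in the domain of
    [g] must be equivalent, which membership in [g] guarantees. *)
Lemma mem_cores f g x y : memB (cores f g) (x, y) <->
  (~ exists z, memB f (x, z)) /\ memB g (x, y).
Proof.
rewrite /cores mem_comp; split=> [[w [xw wy]]|[xf xy]].
  have wx : w = x by apply/funext => i; case/mem_anti: (xw i).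
  by rewrite -wx; split=> //; rewrite wx; case/mem_anti: (xw i0).
by exists x; split=> // i; split=> //; exact: all_equivalent_dom xy.
Qed.

Lemma mem_res f g x y : memB (res f g) (x, y) <->
  (exists z, memB f (x, z)) /\ memB g (x, y).
Proof.
rewrite /res mem_comp; split=> [[w [xw wy]]|[xf xy]].
  have wx : w = x by apply/funext => i; case/mem_anti_anti: (xw i).
  by rewrite -wx; split=> //; rewrite wx; case/mem_anti_anti: (xw i0).
exists x; split=> // i; apply/mem_anti_anti.
by split=> //; exact: all_equivalent_dom xy.
Qed.

Lemma mem_pref f g x y : memB (pref B f g) (x, y) <->
  memB f (x, y) \/ (~ exists z, memB f (x, z)) /\ memB g (x, y).
Proof. by []. Qed.

Lemma mem_foldr_res (t : 'I_n -> B) g s x y :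
  memB (foldr (fun j (u : B) => res (t j) u) g s) (x, y) <->
  (forall j, j \in s -> exists z, memB (t j) (x, z)) /\ memB g (x, y).
Proof.
elim: s => [|j s IHs]; first by split=> [|[]].
rewrite [foldr _ _ _]/= mem_res IHs; split=> [[tj [ts gxy]]|[ts gxy]].
  by split=> // k; rewrite inE => /orP[/eqP ->|/ts].
split; first by apply: ts; rewrite inE eqxx.
by split=> // k ks; apply: ts; rewrite inE ks orbT.
Qed.

Lemma mem_functional f x y z : memB f (x, y) -> memB f (x, z) -> y = z.
Proof. exact: (elements_functional (proj2_sig f)). Qed.

Lemma pf_laws : exists z : B, laws z.
Proof.
have [o] := carrier_nonempty B; pose z := cores o o.
have zN x y : ~ memB z (x, y) by move=> /mem_cores[xo oxy]; apply: xo; exists y.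
have empty f : (forall x y, ~ memB f (x, y)) -> f = z.
  by move=> fN; apply: pf_ext => x y; split=> [/fN|/zN].
exists z; split.
- move=> t s c; apply: pf_ext => x y; rewrite !mem_comp; split.
    case=> w [xw wy]; have /choice[u uP] : forall i, exists u,
        (forall j, memB (t j) (x, u j)) /\ memB (s i) (u, w i).
      by move=> i; apply/mem_comp; exact: xw.
    exists (u i0); split; first by case: (uP i0).
    apply/mem_comp; exists w; split=> // i; suff -> : u i0 = u i by case: (uP i).
    apply/funext => j; exact: mem_functional (proj1 (uP i0) j) (proj1 (uP i) j).
  case=> u [xu /mem_comp[w [uw wy]]]; exists w; split=> // i.
  by apply/mem_comp; exists u.
- move=> a; apply: pf_ext => x y; rewrite mem_cores.
  by split=> [[]|xy] //; split=> // -[w /zN].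
- by move=> a; apply: empty => x y /mem_cores[xa axy]; apply: xa; exists y.
- by move=> t i b ti; apply: empty => x y /mem_comp[w [/(_ i)]]; rewrite ti => /zN.
- by move=> t; apply: empty => x y /mem_comp[w [_ /zN]].
- move=> t i b; apply: pf_ext => x y; rewrite mem_comp mem_cores mem_foldr_res.
  split=> [[w [xw /mem_anti[-> wE wb]]]|[xb [xt txy]]].
    split; last by split=> // j _; exists (w j).
    case=> c /mem_comp[w' [xw' bc]]; apply: wb; exists c.
    suff -> : w = w' by [].
    by apply/funext => j; exact: mem_functional (xw j) (xw' j).
  have /choice[w xw] j : exists w, memB (t j) (x, w) by apply: xt; rewrite mem_enum.
  exists w; split=> //; apply/mem_anti; split.
  + exact: mem_functional txy (xw i).
  + have [refl sym trans] := base_rel_equiv P.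
    have xE k : E (x i) (w k).
      by have [_] := elements_equivalent (proj2_sig (t k)) (xw k); exact.
    by move=> j k; exact: trans (sym _ _ (xE j)) (xE k).
  + by case=> c bc; apply: xb; exists c; apply/mem_comp; exists w.
- move=> a; apply: pf_ext => x y; rewrite mem_res.
  by split=> [[]|xy] //; split=> //; exists y.
- by move=> i j k a; apply: pf_ext => x y; rewrite !mem_anti_anti.
- move=> a b; apply: pf_ext => x y; rewrite mem_res mem_pref.
  split=> [[xa [//|[]//]]|xy]; split; first by exists y.
  by left.
- move=> a b; apply: pf_ext => x y; rewrite !mem_cores mem_pref.
  split=> [[xa [axy|[]//]]|[xa xy]]; first by case: xa; exists y.
  by split=> //; right.
- move=> a b; apply: pf_ext => x y; rewrite mem_pref mem_res mem_cores.
  split=> [[[]//|[_ []//]]|xy].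
  have [xa|xa] := pselect (exists z, memB a (x, z)); first by left.
  by right; split=> //; case=> w /mem_res[].
Qed.

End Soundness.

(** * The Boolean algebra of domains *)

Section Domains.
Variables (n : nat) (A : algebra n) (z : A) (L : laws z) (i0 : 'I_n).
Implicit Types a b c d f g : A.

(** Case analysis on the domain of [a], the only use of preferential union in
    the algebra of domains. *)
Lemma split_eq a (x y : A) : cores a x = cores a y -> res a x = res a y -> x = y.
Proof. by move=> cE rE; rewrite -(pref_split L a x) cE rE (pref_split L). Qed.

Lemma coresE a b : cores a b = comp A (fun i => anti A i a) b. Proof. by []. Qed.

Lemma cores_comp a t b : cores a (comp A t b) = comp A (fun i => cores a (t i)) b.
Proof. by rewrite /cores (comp_assoc L). Qed.

Lemma res_comp a t b : res a (comp A t b) = comp A (fun i => res a (t i)) b.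
Proof. by rewrite /res (comp_assoc L). Qed.

Lemma cores_anti j a b : cores (anti A j a) b = res a b.
Proof.
congr (comp A _ _); apply/funext => i; exact: (anti_antiC L).
Qed.

Lemma res_anti_self j a : res a (anti A j a) = z.
Proof. by rewrite -(cores_anti j) (cores_self L). Qed.

(** The twisted law for a tuple of antidomains. The entries of such a tuple
    share one domain, so the restrictions to these domains in the law are
    absorbed. *)
Lemma cores_antiE i a b :
  cores a (anti A i b) = cores (cores a b) (anti A i a).
Proof.
rewrite [LHS](comp_anti L) -coresE; congr (cores _ _).
elim: (enum 'I_n) => //= j s ->.
rewrite -(cores_anti i0) (anti_antiC L i0 j i) cores_anti.
exact: (res_self L).
Qed.

(** The twisted law of [cores_antiE] holds in every entry of the tuple
    acting on [c], whence this form for the action itself. *)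
Lemma coresC2 a b c : cores a (cores b c) = cores (cores a b) (cores a c).
Proof.
rewrite [cores b c]coresE [cores a c]coresE !cores_comp; congr (comp A _ _).
by apply/funext => i; exact: cores_antiE.
Qed.

Lemma cores_idem a b : cores a (cores a b) = cores a b.
Proof. by rewrite coresC2 (cores_self L) (cores_zero L). Qed.

Lemma res_cores a b : res a (cores a b) = z.
Proof.
by rewrite res_comp; apply: (comp_coord_zero L (i := i0)); rewrite res_anti_self.
Qed.

Lemma cores_anti_self i a : cores a (anti A i a) = anti A i a.
Proof. by rewrite cores_antiE (cores_self L) (cores_zero L). Qed.

Lemma cores_res a b : cores a (res a b) = z.
Proof.
rewrite cores_comp; apply: (comp_coord_zero L (i := i0)).
by rewrite cores_antiE cores_anti_self (cores_self L).
Qed.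

Lemma res_idem a b : res a (res a b) = res a b.
Proof. by rewrite -!(cores_anti i0) cores_idem. Qed.

(** Double complementation: inside the complement of [a] both sides are
    computed by the twisted law, and on [a] both vanish. *)
Lemma res_anti j a b : res (anti A j a) b = cores a b.
Proof.
apply: (@split_eq a).
  rewrite cores_idem [LHS]cores_comp; congr (comp A _ _); apply/funext => i.
  rewrite cores_antiE [cores a (anti A _ _)]cores_antiE cores_anti_self.
  rewrite cores_anti res_anti_self.
  exact: (cores_zero L).
by rewrite res_cores -[LHS](cores_anti j) cores_res.
Qed.

(** Outside [a] the two sides agree by [coresC2]. On [a] both vanish, again by
    [coresC2], which brings [res a] next to [cores a]. *)
Lemma coresC a b c : cores a (cores b c) = cores b (cores a c).
Proof.
apply: (@split_eq a).
  by rewrite cores_idem [in RHS]coresC2 cores_idem -coresC2.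
rewrite res_cores -(cores_anti i0) coresC2 (cores_anti i0 a (cores a c)) res_cores.
by rewrite /cores (comp_zero L).
Qed.

Lemma resC a b c : res a (res b c) = res b (res a c).
Proof. by rewrite -!(cores_anti i0) coresC. Qed.

(** Domains are closed under intersection: the domain of a restriction is the
    intersection of the domains. *)
Lemma res_of_cores a b c : res (cores a b) c = cores a (res b c).
Proof.
apply: (@split_eq a).
  rewrite cores_idem -(cores_anti i0) coresC2 cores_antiE cores_idem.
  by rewrite -cores_antiE -coresC2 cores_anti.
rewrite res_cores -(cores_anti i0) -(cores_anti i0 (cores a b)) coresC2.
rewrite cores_antiE [cores _ (cores a b)]cores_anti res_cores (cores_zero L).
by rewrite !cores_anti res_anti cores_res.
Qed.

Lemma res_of_res a b c : res (res a b) c = res a (res b c).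
Proof. by rewrite -(cores_anti i0 a b) res_of_cores cores_anti. Qed.

(** A composite is defined only where every entry of its tuple is: off the
    domain of [t i] that entry is zero, and zero entries annihilate. *)
Lemma res_coord t i b : res (t i) (comp A t b) = comp A t b.
Proof.
apply: (@split_eq (t i)); last exact: res_idem.
rewrite cores_res cores_comp.
by rewrite (comp_coord_zero L (i := i)) // (cores_self L).
Qed.

Lemma res_zero a : res a z = z. Proof. exact: (comp_zero L). Qed.

(** * Ultrafilters of domains *)

(** An ultrafilter of domains, given as the set of the elements whose domain
    belongs to it. Upward closure and properness follow from the two clauses. *)
Record ultra (U : set A) : Prop := Ultra {
  ultra_anti : forall i a, U (anti A i a) <-> ~ U a;
  ultra_res : forall a b, U (res a b) <-> U a /\ U b }.

Section Separation.
Variables f g : A.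

Local Notation meet := (foldr (@res n A)).

(** The finite intersection property relative to the ideal of the domains on
    which [f] and [g] agree. It is of finite character, hence preserved by unions
    of nonempty chains; for the empty set it says that [f] and [g] differ. *)
Definition consistent (F : set A) : Prop :=
  forall s, List.Forall F s -> meet f s <> meet g s.

Lemma res_meet a b s : res a (meet b s) = meet (res a b) s.
Proof. by elim: s => //= x s <-; rewrite resC. Qed.

Lemma meetC b s1 s2 : meet (meet b s1) s2 = meet (meet b s2) s1.
Proof. by elim: s2 => //= x s2 ->; rewrite res_meet. Qed.

Lemma consistent_max : f <> g -> exists F, consistent F /\
  forall G, (F `<` G)%classic -> ~ consistent G.
Proof.
move=> fg; apply: Zorn_bigcup => C CP Ctot s sC.
have [->//|[X CX sX]] : s = [::] \/ exists2 X, C X & List.Forall X s.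
  elim: sC => [|x {}s [Y CY Yx] _ IHs]; [by left|right].
  have [->|[X CX sX]] := IHs; first by exists Y => //; constructor.
  have [YX|XY] := Ctot _ _ CY CX.
    by exists X => //; constructor=> //; exact: YX.
  by exists Y => //; constructor=> //; apply: List.Forall_impl sX; exact: XY.
exact: CP CX _ sX.
Qed.

(** Isolating a new member [a] of a list, once it has been made to act first,
    where repetitions and absence of [a] are harmless. *)
Lemma res_meet_setU1 (F : set A) a s : List.Forall (F `|` [set a])%classic s ->
  exists s', List.Forall F s' /\
    forall b, meet (res a b) s' = meet (res a b) s.
Proof.
elim=> [|x {}s Fx _ [s' [Fs' s'E]]]; first by exists [::].
case: Fx => [Fx|->].
  by exists (x :: s'); split=> [|b]; [constructor|rewrite /= s'E].
by exists s'; split=> // b; rewrite /= res_meet res_idem.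
Qed.

(** If neither [a] nor its complement belonged to [F], maximality would give
    finitely many members of [F] on which [f] and [g] agree inside [a], and
    finitely many on which they agree outside [a]; on all of these they would
    agree, against consistency. The closure properties follow, since a list of
    members of [F] never acts as zero. *)
Lemma consistent_ultra F : consistent F ->
  (forall G, (F `<` G)%classic -> ~ consistent G) -> ultra F.
Proof.
move=> Fc Fmax.
have extend a : ~ F a -> exists s, List.Forall F s /\
    meet (res a f) s = meet (res a g) s.
  move=> Fa; have /Fmax/existsNP[s /not_implyP[sF /contrapT sE]] :
      (F `<` F `|` [set a])%classic.
    by split=> [x|/(_ a)]; [left|apply: contra_not Fa; apply; right].
  have [s' [Fs' s'E]] := res_meet_setU1 sF; exists s'; split=> //.
  by rewrite !s'E -!res_meet sE.
have total i a : F a \/ F (anti A i a).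
  apply: contrapT => /not_orP[/extend[s1 [F1 E1]] /extend[s2 [F2 E2]]].
  have /Fc : List.Forall F (s1 ++ s2) by apply/List.Forall_app.
  apply; rewrite !foldr_cat; apply: (@split_eq a).
    by rewrite -!(res_anti i) !res_meet E2.
  by rewrite (meetC f) (meetC g) !res_meet E1.
have absurd s : List.Forall F s -> (forall b, meet b s = z) -> False.
  by move=> /Fc + sz; rewrite !sz; exact.
have F2 x y : F x -> F y -> List.Forall F [:: x; y].
  by move=> ? ?; do !constructor.
split=> [i a|a b]; split.
- move=> Fna Fa; apply: absurd (F2 _ _ Fa Fna) _ => b /=.
  by rewrite res_anti res_cores.
- by case: (total i a).
- move=> Fab; split.
    have [//|Fa] := total i0 a; case: (absurd _ (F2 _ _ Fab Fa)) => c /=.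
    by rewrite res_anti res_of_res resC res_cores res_zero.
  have [//|Fb] := total i0 b; case: (absurd _ (F2 _ _ Fab Fb)) => c /=.
  by rewrite res_anti res_of_res res_cores res_zero.
- move=> [Fa Fb]; have [//|Fab] := total i0 (res a b).
  have/absurd[] : List.Forall F [:: a; b; anti A i0 (res a b)] by do !constructor.
  by move=> c /=; rewrite res_anti -res_of_res res_cores.
Qed.

Lemma ultra_separation : f <> g ->
  exists U, ultra U /\ forall a, U a -> res a f <> res a g.
Proof.
move=> /consistent_max[F [Fc Fmax]]; exists F; split; first exact: consistent_ultra.
by move=> a Fa; apply: (Fc [:: a]); do !constructor.
Qed.

End Separation.

(** * Germs of elements at an ultrafilter *)

Section Germs.
Variables (U : set A) (HU : ultra U).

Definition germ_eq a b : Prop := exists2 d, U d & res d a = res d b.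

Lemma ultraN a : ~ U a -> forall i, U (anti A i a).
Proof. by move=> Ua i; apply/(ultra_anti HU). Qed.

Lemma ultra_zero : ~ U z.
Proof.
move=> Uz; have /(ultra_anti HU)/(_ Uz) [] : U (anti A i0 z).
by move: Uz; rewrite -{1}(res_zero (anti A i0 z)) => /(ultra_res HU)[].
Qed.

Lemma ultra_coord t i b : U (comp A t b) -> U (t i).
Proof. by rewrite -(res_coord t i) => /(ultra_res HU)[]. Qed.

Lemma germ_refl a : germ_eq a a.
Proof. by exists (anti A i0 z) => //; exact: ultraN ultra_zero i0. Qed.

Lemma germ_sym a b : germ_eq a b -> germ_eq b a.
Proof. by case=> d Ud dE; exists d. Qed.

Lemma germ_trans a b c : germ_eq a b -> germ_eq b c -> germ_eq a c.
Proof.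
move=> [d Ud dE] [e Ue eE]; exists (res d e); first exact/(ultra_res HU).
by rewrite !res_of_res resC dE resC eE.
Qed.

Lemma germ_res d a : U d -> germ_eq (res d a) a.
Proof. by move=> Ud; exists d => //; exact: res_idem. Qed.

Lemma germ_cores d a : ~ U d -> germ_eq (cores d a) a.
Proof. by move=> /ultraN-/(_ i0) Ud; rewrite -(res_anti i0); exact: germ_res. Qed.

Lemma germ_ultra a b : germ_eq a b -> U a -> U b.
Proof.
case=> d Ud dE Ua.
by have : U (res d a); [exact/(ultra_res HU)|rewrite dE => /(ultra_res HU)[]].
Qed.

(** The finitely many agreements between entries hold on a common member of
    the ultrafilter. *)
Lemma germ_comp (t s : 'I_n -> A) b :
  (forall i, germ_eq (t i) (s i)) -> germ_eq (comp A t b) (comp A s b).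
Proof.
move=> ts; suff [d Ud dE] : exists2 d, U d &
    forall i, i \in enum 'I_n -> res d (t i) = res d (s i).
  exists d => //; rewrite !res_comp; congr (comp A _ _); apply/funext => i.
  by apply: dE; rewrite mem_enum.
elim: (enum 'I_n) => [|i r [d Ud dE]].
  by exists (anti A i0 z) => //; exact: ultraN ultra_zero i0.
have [e Ue eE] := ts i; exists (res e d); first exact/(ultra_res HU).
move=> j; rewrite inE !res_of_res => /orP[/eqP ->|/dE ->//].
by rewrite resC eE resC.
Qed.

Lemma ultra_comp_anti t i b : U (comp A t (anti A i b)) -> ~ U (comp A t b).
Proof.
rewrite (comp_anti L) -(res_anti i0) => /(ultra_res HU)[+ _].
by move=> /(ultra_anti HU).
Qed.

(** By the twisted law the composite is a restriction of [t i] to domains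
    that all belong to the ultrafilter. *)
Lemma germ_comp_anti t i b : (forall j, U (t j)) -> ~ U (comp A t b) ->
  germ_eq (comp A t (anti A i b)) (t i).
Proof.
move=> Ut Utb; rewrite (comp_anti L); apply: germ_trans (germ_cores _ Utb) _.
elim: (enum 'I_n) => [|j s IHs]; first exact: germ_refl.
exact: germ_trans (germ_res _ (Ut j)) IHs.
Qed.

(** Where [<t>; a] is defined, [t] has the germ of its composite with the
    domain tuple of [a], on which the preferential union coincides with [a]. *)
Lemma germ_comp_pref1 t a b : U (comp A t a) ->
  germ_eq (comp A t (pref A a b)) (comp A t a).
Proof.
move=> Uta; rewrite -[in X in germ_eq _ X](res_pref L a b).
rewrite /res -(comp_assoc L); apply: germ_comp => i; apply: germ_sym.
apply: germ_comp_anti => [j|]; first exact: ultra_coord Uta.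
by move=> /ultra_comp_anti; exact.
Qed.

(** The same argument with the antidomain tuple of [a]. *)
Lemma germ_comp_pref2 t a b : (forall j, U (t j)) -> ~ U (comp A t a) ->
  germ_eq (comp A t (pref A a b)) (comp A t b).
Proof.
move=> Ut Uta; apply: (@germ_trans _ (comp A t (cores a (pref A a b)))).
  rewrite /cores -(comp_assoc L); apply: germ_comp => i; apply: germ_sym.
  exact: germ_comp_anti.
rewrite (cores_pref L) /cores -(comp_assoc L); apply: germ_comp => i.
exact: germ_comp_anti.
Qed.

End Germs.

(** * The representation *)

(** A point is an ultrafilter with a germ at it, the germ being encoded by its
    equivalence class. *)
Definition is_point (p : set A * set A) : Prop :=
  ultra p.1 /\ exists2 a, p.1 a & p.2 = germ_eq p.1 a.

Definition point : Type := {p | is_point p}.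

(** Computations with points go through the elements representing them,
    which avoids quotients and dependent types. *)
Definition names (x : point) (U : set A) a : Prop :=
  U a /\ sval x = (U, germ_eq U a).

Definition same_ultra (x y : point) : Prop := (sval x).1 = (sval y).1.

Definition rep f : set (('I_n -> point) * point) :=
  [set p | exists U t, (forall i, names (p.1 i) U (t i)) /\
                       names p.2 U (comp A t f)]%classic.

Lemma names_ultra x U a : names x U a -> ultra U.
Proof. by case: x => -[V G] [HV _] [_ /= [<- _]]. Qed.

Lemma names_same x y U a b : names x U a -> names y U b -> same_ultra x y.
Proof. by rewrite /same_ultra => -[_ ->] [_ ->]. Qed.

Lemma names_inj x y U a : names x U a -> names y U a -> x = y.
Proof.
case: x y => [p Hp] [q Hq] [_ /= pE] [_ /= qE].
by move: Hp Hq; rewrite pE qE => Hp Hq; rewrite (Prop_irrelevance Hp Hq).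
Qed.

Lemma names_germ x U V a b : names x U a -> names x V b ->
  U = V /\ germ_eq U a b.
Proof.
move=> xa [Vb +]; have HU := names_ultra xa; case: xa => Ua -> [UV].
rewrite -UV => ab; split=> //; rewrite ab; exact: germ_refl.
Qed.

Lemma names_eq x U a b : names x U a -> germ_eq U a b -> names x U b.
Proof.
move=> xa ab; have HU := names_ultra xa; case: xa => Ua xE; split.
  exact: germ_ultra ab Ua.
rewrite xE; congr pair; apply/funext => c; apply/propext; split.
  exact: germ_trans (germ_sym ab).
exact: germ_trans ab.
Qed.

Lemma names_exists U a : ultra U -> U a -> exists x, names x U a.
Proof.
move=> HU Ua; have H : is_point (U, germ_eq U a) by split=> //; exists a.
by exists (exist _ _ H).
Qed.

Lemma point_named (x : point) : exists a, names x (sval x).1 a.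
Proof.
case: x => -[U G] [/= HU [a Ua GE]]; exists a; split=> //=.
by rewrite -GE.
Qed.

Lemma tuple_named (x : 'I_n -> point) : all_equivalent same_ultra x ->
  exists U t, ultra U /\ forall i, names (x i) U (t i).
Proof.
move=> xE; have [t tP] := choice (fun i => point_named (x i)).
exists (sval (x i0)).1, t; split; first exact: names_ultra (tP i0).
by move=> i; rewrite (xE i0 i).
Qed.

(** The value computed by [rep] may be read off any representatives of the
    arguments. *)
Lemma repE (x : 'I_n -> point) y U t f : (forall i, names (x i) U (t i)) ->
  rep f (x, y) <-> names y U (comp A t f).
Proof.
move=> xt; split=> [[V [s [/= xs ys]]]|yt]; last by exists U, t.
have [? _] := names_germ (xt i0) (xs i0); subst V.
apply: names_eq ys _; apply: germ_comp; first exact: names_ultra (xt i0).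
by move=> i; have [] := names_germ (xs i) (xt i).
Qed.

Lemma rep_defined (x : 'I_n -> point) U t f : (forall i, names (x i) U (t i)) ->
  (exists y, rep f (x, y)) <-> U (comp A t f).
Proof.
move=> xt; split=> [[y /(repE _ _ xt)[]]//|Ut].
have [y yt] := names_exists (names_ultra (xt i0)) Ut.
by exists y; apply/(repE _ _ xt).
Qed.

Lemma rep_functional f : functional (rep f).
Proof.
move=> x y y' [U [t [xt yt]]] /(repE _ _ xt) yt'; exact: names_inj yt yt'.
Qed.

Lemma rep_equivalent f : entries_equivalent same_ultra (rep f).
Proof.
move=> x y [U [t [/= xt yt]]]; split=> [i j|i].
  exact: names_same (xt i) (xt j).
exact: names_same (xt i) yt.
Qed.

Lemma pair_ext (S T : Type) (F G : set (S * T)) :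
  (forall x y, F (x, y) <-> G (x, y)) -> F = G.
Proof. by move=> FG; apply/funext => -[x y]; apply/propext; exact: FG. Qed.

Lemma rep_comp t g : rep (comp A t g) = pf_comp (fun i => rep (t i)) (rep g).
Proof.
apply: pair_ext => x y; split.
  case=> U [s [/= xs]]; rewrite -(comp_assoc L) => yE.
  have HU := names_ultra yE.
  have /choice[w wE] i : exists w, names w U (comp A s (t i)).
    apply: names_exists => //.
    exact: (@ultra_coord U HU (fun i => comp A s (t i)) i g (proj1 yE)).
  exists w; split=> [i|]; first exact/(repE _ _ xs).
  by exists U, (fun i => comp A s (t i)).
case=> w [/= xw wy]; have [U [s [/= xs _]]] := xw i0.
have ws i : names (w i) U (comp A s (t i)) by apply/(repE _ _ xs); exact: xw.
by apply/(repE _ _ xs); rewrite -(comp_assoc L); apply/(repE _ _ ws).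
Qed.

Lemma rep_anti i f : rep (anti A i f) = pf_anti same_ultra i (rep f).
Proof.
apply: pair_ext => x y; split=> [xy|[/= -> xE]].
  have [xE _] := rep_equivalent xy; have [U [t [HU xt]]] := tuple_named xE.
  move: xy => /(repE _ _ xt) yt; have Utf := ultra_comp_anti HU (proj1 yt).
  split=> //=; last by move=> /(rep_defined _ xt).
  apply: names_inj yt _; apply: names_eq (xt i) _; apply: germ_sym.
  by apply: germ_comp_anti => // j; case: (xt j).
have [U [t [HU xt]]] := tuple_named xE; move=> /(rep_defined _ xt) Utf.
apply/(repE _ _ xt); apply: names_eq (xt i) _; apply: germ_sym.
by apply: germ_comp_anti => // j; case: (xt j).
Qed.

Lemma rep_pref f g : rep (pref A f g) = pf_pref (rep f) (rep g).
Proof.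
apply: pair_ext => x y.
have [xE|xE] := pselect (all_equivalent same_ultra x); last first.
  by split=> [/rep_equivalent[]//|[/rep_equivalent[]//|[_ /rep_equivalent[]//]]].
have [U [t [HU xt]]] := tuple_named xE.
have Ut j : U (t j) by case: (xt j).
rewrite /pf_pref /= (repE _ _ xt) (repE _ f xt) (repE _ g xt) (rep_defined f xt).
have [Utf|Utf] := pselect (U (comp A t f)).
  have fg := germ_comp_pref1 HU g Utf; split=> [yt|[yt|[]//]].
    by left; exact: names_eq yt fg.
  exact: names_eq yt (germ_sym fg).
have fg := germ_comp_pref2 HU g Ut Utf; split=> [yt|[[/Utf]//|[_ yt]]].
  by right; split=> //; exact: names_eq yt fg.
exact: names_eq yt (germ_sym fg).
Qed.

(** At a separating ultrafilter the two functions already differ on the tuple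
    of the germs of the projections, where [f] takes the germ of [f] as value.
    If both are undefined there, they agree, being zero, on the intersection of
    the complements of their domains, which belongs to the ultrafilter. *)
Lemma rep_inj : injective rep.
Proof.
move=> f g fg; apply: contrapT => /ultra_separation[U [HU Usep]].
have /choice[p pP] i : exists x, names x U (anti A i z).
  by apply: names_exists => //; exact: ultraN (ultra_zero HU) i.
have pf a y : rep a (p, y) <-> names y U a.
  by rewrite (repE _ _ pP) -/(cores z a) (cores_zero L).
have Ufg a b : rep a = rep b -> U a -> germ_eq U a b.
  move=> ab Ua; have [y ya] := names_exists HU Ua.
  have /pf yb : rep b (p, y) by rewrite -ab; apply/pf.
  by have [] := names_germ ya yb.
have [Uf|Uf] := pselect (U f); first by have [d /Usep] := Ufg _ _ fg Uf.
have Ug : ~ U g by move=> Ug; apply: Uf; exact: germ_ultra (Ufg _ _ (esym fg) Ug) Ug.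
apply: (Usep (res (anti A i0 f) (anti A i0 g))).
  by apply/(ultra_res HU); split; exact: ultraN.
rewrite !res_of_res !res_anti (cores_self L) coresC (cores_self L).
by rewrite /cores !(comp_zero L).
Qed.

Lemma same_ultra_equiv : RelationClasses.Equivalence same_ultra.
Proof.
by split=> [x|x y|x y w]; rewrite /same_ultra //; exact: etrans.
Qed.

Definition rep_pf : pf_algebra n.
Proof.
refine (@PfAlgebra n point same_ultra same_ultra_equiv (range rep)%classic
  _ _ _ _ _ _).
- by have [a] := carrier_nonempty A; exists (rep a), a.
- by move=> _ [f _ <-]; exact: rep_functional.
- by move=> _ [f _ <-]; exact: rep_equivalent.
- move=> fs _ fsP [g _ <-].
  have /choice[t tP] i : exists a, rep a = fs i by have [a _ <-] := fsP i; exists a.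
  exists (comp A t g) => //; rewrite rep_comp; congr pf_comp.
  exact/funext.
- by move=> i _ [f _ <-]; exists (anti A i f) => //; exact: rep_anti.
- by move=> _ _ [f _ <-] [g _ <-]; exists (pref A f g) => //; exact: rep_pref.
Defined.

Lemma sval_inj (T : Type) (Q : T -> Prop) : injective (@sval T Q).
Proof.
by move=> [x Qx] [y Qy] /= xy; subst y; rewrite (Prop_irrelevance Qx Qy).
Qed.

Lemma laws_representable : representable A.
Proof.
exists rep_pf.
pose h a : algebra_of_pf rep_pf := exist _ (rep a) (ex_intro2 _ _ a Logic.I erefl).
exists h.
  split=> [t g|i f|f g]; apply: sval_inj; [exact: rep_comp|exact: rep_anti|].
  exact: rep_pref.
have h_surj y : exists a, h a = y.
  by case: (proj2_sig y) => a _ aF; exists a; apply: sval_inj.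
have [k kP] := choice h_surj; exists k => // a.
by apply: rep_inj; exact: (f_equal sval (kP (h a))).
Qed.

End Domains.

(** * The variety *)

Section Variety.
Variables (n : nat) (hn : (0 < n)%N).

(** The valuation is lifted along the surjection by choice. *)
Lemma satisfies_image (A B : algebra n) (h : A -> B) e : homomorphism h ->
  (forall y, exists x, h x = y) -> satisfies A e -> satisfies B e.
Proof.
move=> hom /choice[k hk] Ae v.
have hE := eval_hom hom (v := k \o v) (fun x => hk (v x)).
by rewrite -!hE Ae.
Qed.

Lemma satisfies_sub (A B : algebra n) (h : B -> A) e : homomorphism h ->
  injective h -> satisfies A e -> satisfies B e.
Proof.
move=> hom hI Ae v; apply: hI.
by rewrite !(eval_hom hom (w := h \o v)).
Qed.

Lemma satisfies_prod (I : Type) (A : I -> algebra n) e :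
  (forall i, satisfies (A i) e) -> satisfies (prod_algebra A) e.
Proof.
move=> Ae v; apply: (@functional_extensionality_dep I A) => i.
have hom : @homomorphism n (prod_algebra A) (A i) (fun f => f i) by split.
have evalE := eval_hom hom (v := v) (w := fun x => v x i) (fun=> erefl).
exact: etrans (evalE _) (etrans (Ae i _) (esym (evalE _))).
Qed.

Lemma representable_axiomatised : axiomatised_by (@representable n) (pf_axioms n).
Proof.
move=> A; split=> [[P [h hom hB]] e eL|/satisfies_laws[z L]].
  apply: satisfies_sub hom (bij_inj hB) _.
  by have [z L] := pf_laws hn P; exact: laws_satisfies L e eL.
exact: (laws_representable L (Ordinal hn)).
Qed.

Lemma axiomatised_variety (K : algebra n -> Prop) L :
  axiomatised_by K L -> is_variety K.
Proof.
move=> KL; split.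
- move=> A B h hom hS /KL Ae; apply/KL => e /Ae; exact: satisfies_image hom hS.
- move=> A B h hom hI /KL Ae; apply/KL => e /Ae; exact: satisfies_sub hom hI.
- move=> I A B [h hom hB] KA; apply/KL => e eL.
  apply: satisfies_sub hom (bij_inj hB) _; apply: satisfies_prod => i.
  by move/KL: (KA i); exact.
Qed.

End Variety.

Theorem theorem7p3 (n : nat) (hn : (1 <= n)%N) :
  is_variety (@representable n) /\ axiomatised_by (@representable n) (pf_axioms n).
Proof.
have KL := representable_axiomatised hn.
by split=> //; exact: axiomatised_variety KL.
Qed.
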